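(* Let $p$ be an odd prime such that the order $g$ of $2$ in the multiplicative group $\mathbb{Z}_p^*$ is even. Let $n=2^{c}+2^{b}+2^{a}$ where $c>b>a\ge 0$ are integers and $n\ge 11$. If $\{a,b,c\}\equiv\{1,g/2,g/2\} \bmod g$ (as multisets of residues modulo $g$), then $2^{c}$, $2^{b}$ and $2^{a}$ are non-essential for $n$ in base $p$. Furthermore, the element $7$ is non-essential for $n$ in both base $2$ and base $p$. Hence $\Phi_{2p}$ is a factor of $Q_{n}(t)$.
   Context: For $S\subseteq[n-1]=\{1,\dots,n-1\}$ let $\beta_n(S)$ be the number of permutations $\pi\in\mathfrak{S}_n$ with descent set $\{i\in[n-1] : \pi_i>\pi_{i+1}\}$ equal to $S$. The $n$th descent set polynomial is $Q_n(t)=\sum_{S\subseteq[n-1]}t^{\beta_n(S)}$. $\Phi_m(t)$ denotes the $m$th cyclotomic polynomial; factors are in $\mathbb{Q}[t]$. For a prime $\ell$ and $1\le k\le n-1$, write $n=\sum_i n_i\ell^i$, $k=\sum_i k_i\ell^i$ with $0\le n_i,k_i<\ell$; $k$ is essential for $n$ in base $\ell$ if $k_i\le n_i$ for all $i$, and non-essential otherwise. *)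

(* Defs.v *)
From HB Require Import structures.
From mathcomp Require Import all_boot all_order all_fingroup all_algebra all_field.

Set Implicit Arguments.
Unset Strict Implicit.
Unset Printing Implicit Defensive.

Import GRing.Theory.
Local Open Scope nat_scope.

(* [n-1] = {1, ..., n-1} is the set of nonzero elements of 'I_n, so its elements
   keep their usual values. *)
Definition positions (n : nat) : {set 'I_n} := [set i : 'I_n | 0 < i].

(* A permutation s : 'S_n has one-line notation pi_j = s (j - 1) for j in [n];
   for 0 < i the condition pi_i > pi_(i+1) thus reads s (i - 1) > s i, and
   ord_pred i has value i - 1. *)
Definition descent_set (n : nat) (s : 'S_n) : {set 'I_n} :=
  [set i in positions n | s (ord_pred i) > s i].

Definition beta (n : nat) (S : {set 'I_n}) : nat :=
  #|[set s : 'S_n | descent_set s == S]|.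

Definition descent_poly (n : nat) : {poly rat} :=
  (\sum_(S : {set 'I_n} | S \subset positions n) 'X^(beta S))%R.

(* Coefficient of l ^ i in the base-l expansion of k, for l > 1. *)
Definition digit (l k i : nat) : nat := (k %/ l ^ i) %% l.

Definition essential (l n k : nat) : Prop :=
  0 < k < n /\ (forall i, digit l k i <= digit l n i).

(* The notions are only defined for 1 <= k <= n - 1, so nonessential carries
   this range as well instead of being the bare negation of essential. *)
Definition nonessential (l n k : nat) : Prop :=
  0 < k < n /\ ~ essential l n k.

(* Main.v *)
Require Import Defs.
From HB Require Import structures.
From mathcomp Require Import all_boot all_order all_fingroup all_algebra all_field.
From mathcomp Require Import cyclic zify.

(* Counting the permutations whose descent set agrees with S away from k
   gives beta_n(S) + beta_n(S xor {k}) = C(n, k) beta_k(S') beta_(n-k)(S''),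
   where S' and S'' are the traces of S on both sides of k.

   Modulo p: 2 ^ (g / 2) = -1 in Z_p, so p divides n and hence C(n, k) for
   every k prime to p; toggling such a k negates beta modulo p.

   Modulo 2: beta_m is always odd when m is a power of 2, and if m is a sum of
   two distinct powers of 2 then beta_m(S) is odd iff S contains both or none
   of them. So toggling 2 ^ x with x in {a, b, c} flips the parity of beta_n(S)
   as soon as S contains both or none of the sums 2 ^ x + 2 ^ y, with y the
   other two exponents. There are three such sums, each in S or not, so two of
   them agree and some x has this property. Toggling 7 keeps the parity.

   Toggling this 2 ^ x together with 7 is thus an involution that preserves
   beta_n modulo p and flips its parity. At a primitive 2p-th root of unity w
   one has w ^ p = -1, so paired terms of Q_n(w) cancel. *)

Set Implicit Arguments.
Unset Strict Implicit.
Unset Printing Implicit Defensive.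

Import GRing.Theory.
Local Open Scope nat_scope.

(** * Toggling one position *)

(** Descents are prescribed by a predicate on [nat], so that cutting at [k] and shifting by [k] need
    no change of type. As in [descent_set], a descent from [i] to [i.+1] is recorded at [i.+1]. *)
Definition has_descents n (P : pred nat) (s : 'S_n) : bool :=
  [forall i : 'I_n, forall j : 'I_n,
    (j == i.+1 :> nat) ==> ((s j < s i) == P j)].

Definition has_descents_off n k (P : pred nat) (s : 'S_n) : bool :=
  [forall i : 'I_n, forall j : 'I_n,
    (j == i.+1 :> nat) && (j != k :> nat) ==> ((s j < s i) == P j)].

Definition num_descents n (P : pred nat) : nat :=
  #|[set s : 'S_n | has_descents P s]|.

Definition toggle k (P : pred nat) : pred nat := fun i => P i (+) (i == k).

Lemma has_descentsP n (P : pred nat) (s : 'S_n) :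
  reflect (forall i j : 'I_n, j = i.+1 :> nat -> (s j < s i) = P j)
          (has_descents P s).
Proof.
apply: (iffP forallP) => H i; last first.
  by apply/forallP => j; apply/implyP => /eqP /H ->.
by move=> j ji; move/forallP/(_ j): (H i); rewrite ji eqxx -ji => /eqP.
Qed.

Lemma has_descents_offP n k (P : pred nat) (s : 'S_n) :
  reflect (forall i j : 'I_n, j = i.+1 :> nat -> j <> k :> nat ->
             (s j < s i) = P j)
          (has_descents_off k P s).
Proof.
apply: (iffP forallP) => H i; last first.
  by apply/forallP => j; apply/implyP => /andP[/eqP ji /eqP jk]; rewrite H.
move=> j ji /eqP jk; move/forallP/(_ j): (H i).
by rewrite jk ji eqxx -ji => /eqP.
Qed.

Lemma eq_num_descents n (P Q : pred nat) :
  (forall i, 0 < i < n -> P i = Q i) -> num_descents n P = num_descents n Q.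
Proof.
move=> PQ; apply: eq_card => s; rewrite !inE.
by apply/has_descentsP/has_descentsP => H i j ji;
  rewrite H // PQ // ltn_ord ji.
Qed.

(** With position [k] left free, a permutation behaves there either as [P] says or the opposite way,
    never both. *)
Lemma card_has_descents_off n k (P : pred nat) : 0 < k < n ->
  #|[set s : 'S_n | has_descents_off k P s]| =
  num_descents n P + num_descents n (toggle k P).
Proof.
case/andP=> k_gt0 k_lt.
have k1_lt : k.-1 < n by lia.
pose j0 := Ordinal k_lt; pose i0 := Ordinal k1_lt.
have j0E : j0 = i0.+1 :> nat by rewrite /= prednK.
have -> : [set s : 'S_n | has_descents_off k P s] =
    [set s | has_descents P s] :|: [set s | has_descents (toggle k P) s].
  apply/setP => s; rewrite !inE; apply/has_descents_offP/orP => [H|].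
    have [E|NE] := boolP ((s j0 < s i0) == P k); [left|right].
      apply/has_descentsP => i j ji; have [jk|/eqP jk] := eqVneq (nat_of_ord j) k.
        have -> : j = j0 by apply: val_inj.
        have -> : i = i0 by apply: val_inj => /=; lia.
      exact: (eqP E).
      by apply: H.
    apply/has_descentsP => i j ji; rewrite /toggle.
    have [jk|/eqP jk] := eqVneq (nat_of_ord j) k.
      have -> : j = j0 by apply: val_inj.
      have -> : i = i0 by apply: val_inj => /=; lia.
      by move: NE => /=; case: (_ < _); case: (P k).
    by rewrite addbF H.
  case=> /has_descentsP H i j ji /eqP /negbTE jk; rewrite H //.
  by rewrite /toggle jk addbF.
rewrite cardsU; suff -> : [set s : 'S_n | has_descents P s] :&:
    [set s | has_descents (toggle k P) s] = set0 by rewrite cards0 subn0.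
apply/setP => s; rewrite !inE; apply/negP => /andP[/has_descentsP/(_ _ _ j0E) E].
by move/has_descentsP/(_ _ _ j0E); rewrite E /toggle /= eqxx; case: (P k).
Qed.

(** * Permutations with a free position as shuffles *)

Section Shuffle.
Variables k m : nat.
Implicit Types (P : pred nat) (A : {set 'I_(k + m)}) (s : 'S_(k + m)).

Let low := [set i : 'I_(k + m) | i < k].

Lemma card_low : #|low| = k.
Proof.
have -> : low = [set lshift m i | i : 'I_k].
  apply/setP => i; rewrite inE; apply/idP/imsetP => [ik|[j _ ->]] /=; last first.
    exact: ltn_ord.
  by exists (Ordinal ik) => //; apply: val_inj.
by rewrite card_imset ?card_ord //; exact: lshift_inj.
Qed.

(* The inverse of the shuffle sending [0, k) increasingly onto A and [k, k + m)
   increasingly onto its complement. *)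
Lemma unshuffle A : #|A| = k -> exists r : 'S_(k + m),
  r @: A = low /\
  forall x y, (x \in A) = (y \in A) -> (r x < r y) = (x < y).
Proof.
move=> cardA.
have cardCA : #|~: A| = m.
  by have := cardsC A; rewrite cardA card_ord => /addnI.
(* The rank of [x] within its own block, moved up by [k] outside [A]. *)
pose f (x : 'I_(k + m)) := if x \in A then #|[set y in A | y < x]|
   else k + #|[set y in ~: A | y < x]|.
have mono (B : {set 'I_(k + m)}) (x y : 'I_(k + m)) : x \in B -> x < y ->
    #|[set z in B | z < x]| < #|[set z in B | z < y]|.
  move=> xB xy; apply: proper_card; apply/properP; split.
    apply/subsetP => z; rewrite !inE => /andP[-> /= zx]; exact: ltn_trans xy.
  by exists x; rewrite !inE xB ?xy ?ltnn.
have bnd (B : {set 'I_(k + m)}) (x : 'I_(k + m)) : x \in B ->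
    #|[set z in B | z < x]| < #|B|.
  move=> xB; apply: proper_card; apply/properP; split.
    by apply/subsetP => z; rewrite !inE => /andP[].
  by exists x; rewrite ?inE ?ltnn ?andbF.
have fA x : x \in A -> f x < k by move=> xA; have := bnd _ _ xA; rewrite /f xA cardA.
have fCA x : x \notin A -> k <= f x by move=> /negbTE xA; rewrite /f xA leq_addr.
have f_lt x : f x < k + m.
  have [xA|xA] := boolP (x \in A); first by rewrite ltn_addr ?fA.
  have := bnd (~: A) x; rewrite inE xA cardCA => /(_ isT).
  by rewrite /f (negbTE xA) ltn_add2l.
have f_mono x y : (x \in A) = (y \in A) -> x < y -> f x < f y.
  move=> E xy; rewrite /f -E; case: ifP => xA; first exact: mono.
  by rewrite ltn_add2l mono // inE xA.
pose g x := Ordinal (f_lt x).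
have g_inj : injective g.
  move=> x y /(congr1 val) /= E.
  have EA : (x \in A) = (y \in A).
    have [xA|xA] := boolP (x \in A); have [yA|yA] := boolP (y \in A) => //.
      by have := fA _ xA; have := fCA _ yA; lia.
    by have := fA _ yA; have := fCA _ xA; lia.
  have [xy|yx|//] := ltngtP x y; last exact: val_inj.
    by have := f_mono _ _ EA xy; rewrite E ltnn.
  by have := f_mono _ _ (esym EA) yx; rewrite E ltnn.
exists (perm g_inj); split.
  apply/eqP; rewrite eqEcard (card_imset _ perm_inj) cardA card_low leqnn andbT.
  by apply/subsetP => _ /imsetP[x xA ->]; rewrite inE permE fA.
move=> x y E; rewrite !permE /=; have [xy|yx|/val_inj ->] := ltngtP x y.
- exact: f_mono.
- by apply/negbTE; rewrite -leqNgt ltnW ?f_mono.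
- exact: ltnn.
Qed.

(** Permutations are grouped by the image [A] of [low]. Composing with the [r] of [unshuffle]
    matches the group of [A] with that of [low]: it keeps comparisons within a block, and only
    position [k] compares entries of different blocks. *)
Lemma card_off_shuffle P :
  #|[set s : 'S_(k + m) | has_descents_off k P s]| =
  'C(k + m, k) *
    #|[set s : 'S_(k + m) | has_descents_off k P s && (s @: low == low)]|.
Proof.
rewrite -{1}sum1_card.
rewrite (partition_big (fun s : 'S_(k + m) => s @: low) (fun A => #|A| == k)) /=;
  last by move=> s _; rewrite (card_imset _ perm_inj) card_low.
under eq_bigr => A /eqP cardA.
  have [r [rA r_mono]] := unshuffle cardA.
  have -> : \sum_(s in [set s : 'S_(k + m) | has_descents_off k P s]
                 | s @: low == A) 1 =
      #|[set s : 'S_(k + m) | has_descents_off k P s && (s @: low == low)]|.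
    rewrite -sum1_card (reindex_inj (mulIg r^-1)%g) /=.
    apply: eq_bigl => s0; rewrite !inE -{3 4}(mulgKV r s0).
    move: (s0 * r^-1)%g => s.
    have -> : (s * r)%g @: low = r @: (s @: low).
      by rewrite -imset_comp; apply: eq_imset => x; rewrite /= permM.
    have -> : (r @: (s @: low) == low) = (s @: low == A).
      by rewrite -{2}rA (inj_eq (imset_inj perm_inj)).
    have [sA|] := eqVneq (s @: low) A; rewrite ?andbF // !andbT.
    have in_A x : (s x \in A) = (x < k).
      by rewrite -sA (mem_imset _ _ perm_inj) inE.
    have E (i j : 'I_(k + m)) : j = i.+1 :> nat -> j <> k :> nat ->
        ((s * r)%g j < (s * r)%g i) = (s j < s i).
      by move=> ji jk; rewrite !permM r_mono // !in_A; lia.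
    by apply/has_descents_offP/has_descents_offP => H i j ji jk;
      rewrite -(H i j) // E.
  over.
rewrite sum_nat_const; congr (_ * _).
have := card_draws 'I_(k + m) k; rewrite card_ord => <-.
by apply: eq_card => A; rewrite inE.
Qed.

Definition sum_perm_fun (l : 'S_k) (r : 'S_m) (i : 'I_(k + m)) : 'I_(k + m) :=
  match split i with
  | inl x => lshift m (l x)
  | inr y => rshift k (r y)
  end.

Lemma sum_perm_fun_inj l r : injective (sum_perm_fun l r).
Proof.
move=> i j; rewrite /sum_perm_fun.
case: split_ordP => x ->; case: split_ordP => y -> E.
- by move/lshift_inj/perm_inj: E => ->.
- by move/(congr1 val): E => /=; have := ltn_ord (l x); lia.
- by move/(congr1 val): E => /=; have := ltn_ord (l y); lia.
- by move/rshift_inj/perm_inj: E => ->.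
Qed.

Definition sum_perm (l : 'S_k) (r : 'S_m) : 'S_(k + m) :=
  perm (@sum_perm_fun_inj l r).

Lemma sum_perm_lshift l r x : sum_perm l r (lshift m x) = lshift m (l x).
Proof. by rewrite permE /sum_perm_fun (unsplitK (inl x)). Qed.

Lemma sum_perm_rshift l r y : sum_perm l r (rshift k y) = rshift k (r y).
Proof. by rewrite permE /sum_perm_fun (unsplitK (inr y)). Qed.

Lemma sum_perm_inj : injective (fun lr => sum_perm lr.1 lr.2).
Proof.
move=> [l r] [l' r'] /= E; congr pair; apply/permP => x.
  by apply: (@lshift_inj k m); rewrite -(sum_perm_lshift l r) E sum_perm_lshift.
by apply: (@rshift_inj k m); rewrite -(sum_perm_rshift l r) E sum_perm_rshift.
Qed.

Lemma sum_perm_low l r : sum_perm l r @: low = low.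
Proof.
apply/eqP; rewrite eqEcard (card_imset _ perm_inj) leqnn andbT.
apply/subsetP => _ /imsetP[x xk ->]; rewrite inE in xk *.
case: (split_ordP x) xk => y -> /=; last by lia.
by rewrite sum_perm_lshift ?inE /= ltn_ord.
Qed.

Lemma low_sum_perm s : s @: low = low -> exists l r, s = sum_perm l r.
Proof.
move=> s_low.
have s_lt x : (s x < k) = (x < k).
  by have := mem_imset low x (@perm_inj _ s); rewrite s_low !inE.
(* The [else] branches are never reached, since [s] preserves [low]. *)
pose fl x := if split (s (lshift m x)) is inl z then z else x.
pose fr x := if split (s (rshift k x)) is inr z then z else x.
have flE x : lshift m (fl x) = s (lshift m x).
  have := s_lt (lshift m x); rewrite /fl.
  case: split_ordP => z -> //=; have := ltn_ord x; have := ltn_ord z; lia.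
have frE x : rshift k (fr x) = s (rshift k x).
  have := s_lt (rshift k x); rewrite /fr.
  case: split_ordP => z -> //=; have := ltn_ord x; have := ltn_ord z; lia.
have fl_inj : injective fl.
  by move=> x y /(congr1 (lshift m)); rewrite !flE => /perm_inj/lshift_inj.
have fr_inj : injective fr.
  by move=> x y /(congr1 (@rshift k m)); rewrite !frE => /perm_inj/rshift_inj.
exists (perm fl_inj), (perm fr_inj); apply/permP => x.
case: (split_ordP x) => y ->.
  by rewrite sum_perm_lshift permE flE.
by rewrite sum_perm_rshift permE frE.
Qed.

(** The only adjacent pair straddling the two blocks is recorded at [k], which is left free. *)
Lemma has_descents_off_sum P l r :
  has_descents_off k P (sum_perm l r) =
  has_descents P l && has_descents (fun i => P (k + i)) r.
Proof.
apply/has_descents_offP/andP => [H|[/has_descentsP Hl /has_descentsP Hr]].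
  split; apply/has_descentsP => i j ji.
    have := H (lshift m i) (lshift m j).
    rewrite !sum_perm_lshift; apply=> //=; have := ltn_ord j; lia.
  have := H (rshift k i) (rshift k j).
  by rewrite !sum_perm_rshift /= ltn_add2l; apply=> //=; lia.
move=> i j; case: (split_ordP i) => i' ->; case: (split_ordP j) => j' -> /= ji jk.
- by rewrite !sum_perm_lshift /= Hl.
- by have := ltn_ord i'; lia.
- by have := ltn_ord j'; lia.
- by rewrite !sum_perm_rshift /= ltn_add2l (Hr i') //; lia.
Qed.

Lemma card_off_low P :
  #|[set s : 'S_(k + m) | has_descents_off k P s && (s @: low == low)]| =
  num_descents k P * num_descents m (fun i => P (k + i)).
Proof.
rewrite /num_descents -cardsX -(card_imset _ sum_perm_inj); congr #|pred_of_set _|.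
apply/setP => s; rewrite inE; apply/andP/imsetP => [[Hs /eqP]|].
  case/low_sum_perm=> l [r sE]; exists (l, r) => //=.
  by rewrite in_setX !inE -has_descents_off_sum -sE.
case=> [[l r]]; rewrite in_setX !inE /= => lr ->.
by rewrite has_descents_off_sum sum_perm_low.
Qed.

End Shuffle.

Lemma num_descents_toggle n k (P : pred nat) : 0 < k < n ->
  num_descents n P + num_descents n (toggle k P) =
  'C(n, k) * (num_descents k P * num_descents (n - k) (fun i => P (k + i))).
Proof.
move=> kn; rewrite -card_has_descents_off //.
have [m ->] : exists m, n = k + m by exists (n - k); lia.
by rewrite addKn card_off_shuffle card_off_low.
Qed.

(** * Parity *)

Lemma num_descents0 n : num_descents n xpred0 = 1.
Proof.
rewrite /num_descents; have -> : [set s : 'S_n | has_descents xpred0 s] = [set 1%g].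
  apply/setP => s; rewrite !inE; apply/has_descentsP/eqP => [H|-> i j ji].
    have H' (i j : 'I_n) : j = i.+1 :> nat -> s i < s j.
      move=> ji; rewrite ltn_neqAle leqNgt (H _ _ ji) andbT.
      by rewrite (inj_eq val_inj) (inj_eq perm_inj) -(inj_eq val_inj) /= ji; lia.
    (* An increasing permutation moves nothing down, by induction from the left, and nothing up, by
       induction from the right. *)
    have ge_id d (i : 'I_n) : i = d :> nat -> i <= s i.
      elim: d i => [|d IH] i iE; first by rewrite iE.
      have d_lt : d < n by have := ltn_ord i; lia.
      by have := IH (Ordinal d_lt) erefl; have := H' (Ordinal d_lt) i; rewrite /=; lia.
    have le_id d (i : 'I_n) : n = i.+1 + d -> s i <= i.
      elim: d i => [|d IH] i nE; first by have := ltn_ord (s i); lia.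
      have i_lt : i.+1 < n by lia.
      have := IH (Ordinal i_lt); have := H' i (Ordinal i_lt); rewrite /=; lia.
    apply/permP => i; rewrite perm1; apply/val_inj/eqP => /=.
    rewrite eqn_leq (ge_id _ _ erefl) andbT (le_id (n - i.+1)) //.
    by have := ltn_ord i; lia.
  by rewrite !perm1 ji ltnNge leqnSn.
exact: cards1.
Qed.

(** The true positions of [P] are toggled off one at a time from the top; [d] bounds those that
    remain. Toggle-invariant quantities can thus be computed at the empty descent set. *)
Lemma toggle_invariant n T (F : pred nat -> T) :
  (forall P Q, (forall i, 0 < i < n -> P i = Q i) -> F P = F Q) ->
  (forall P k, 0 < k < n -> F (toggle k P) = F P) ->
  forall P, F P = F xpred0.
Proof.
move=> F_ext F_tog P.
suff H d (Q : pred nat) : (forall i, d <= i < n -> Q i = false) -> F Q = F xpred0.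
  by apply: (H n) => i; lia.
elim: d Q => [|d IH] Q Q0; first by apply: F_ext => i /andP[_ i_lt]; rewrite Q0.
have [d0|d_gt0] := posnP d; first by apply: F_ext => i i_in; rewrite Q0 //; lia.
have [n_d|d_n] := leqP n d; first by apply: IH => i; lia.
have [Qd|Qd] := boolP (Q d).
  rewrite -(F_tog _ d) ?d_gt0 //; apply: IH => i i_in; rewrite /toggle.
  have [->|i_d] := eqVneq i d; first by rewrite Qd.
  by rewrite addbF Q0 //; lia.
apply: IH => i i_in; have [->|i_d] := eqVneq i d; first exact: negbTE.
by rewrite Q0 //; lia.
Qed.

Lemma odd_num_descents_toggle n k (P : pred nat) : 0 < k < n ->
  odd (num_descents n (toggle k P)) = odd (num_descents n P) (+)
  (odd 'C(n, k) && odd (num_descents k P) &&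
   odd (num_descents (n - k) (fun i => P (k + i)))).
Proof.
move=> kn; have /(congr1 odd) := num_descents_toggle P kn.
by rewrite oddD !oddM -andbA => <-; rewrite addbA addbb.
Qed.

(** Modulo 2, (1 + X)^(2^u + m) = (1 + X^(2^u)) (1 + X)^m. The induction splits 2^(u+1) into 2^u +
    2^u, and the two middle terms cancel. *)
Lemma odd_bin_pow2D u m k : odd 'C(2 ^ u + m, k) =
  odd 'C(m, k) (+) ((2 ^ u <= k) && odd 'C(m, k - 2 ^ u)).
Proof.
elim: u m k => [|u IH] m k.
  by case: k => [|k]; rewrite expn0 add1n ?bin0 // binS oddD subn1.
rewrite expnS mul2n -addnn -addnA !IH -addbA; congr (_ (+) _).
have [uk|ku] := leqP (2 ^ u) k; last by have -> : (2 ^ u + 2 ^ u <= k) = false by lia.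
by rewrite /= subnDA leq_subRL // addbA addbb.
Qed.

Lemma odd_bin0 k : odd 'C(0, k) = (k == 0).
Proof. by rewrite bin0n; case: (k == 0). Qed.

Lemma odd_bin_pow2 u k : odd 'C(2 ^ u, k) = (k == 0) (+) (k == 2 ^ u).
Proof.
rewrite -[2 ^ u]addn0 odd_bin_pow2D !odd_bin0 addn0; congr (_ (+) _).
by rewrite subn_eq0 eqn_leq andbC.
Qed.

(** The inner binomial coefficients of 2^u are even, so no toggle changes the parity. *)
Lemma odd_num_descents_pow2 u (P : pred nat) : odd (num_descents (2 ^ u) P).
Proof.
rewrite (@toggle_invariant (2 ^ u) _ (fun P => odd (num_descents (2 ^ u) P))).
- by rewrite num_descents0.
- by move=> Q R QR; rewrite (eq_num_descents QR).
move=> Q k kn; rewrite odd_num_descents_toggle // odd_bin_pow2.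
have -> : (k == 0) = false by lia.
have -> : (k == 2 ^ u) = false by lia.
by rewrite /= addbF.
Qed.

(** For 0 < k < n, C(n, k) is odd only at k = 2^u and k = 2^v, where both blocks have odd counts.
    Toggling there flips both the parity and [G], so their exclusive or is toggle-invariant. *)
Lemma odd_num_descents_pow2D u v (P : pred nat) : u != v ->
  odd (num_descents (2 ^ u + 2 ^ v) P) = (P (2 ^ u) == P (2 ^ v)).
Proof.
move=> uv; have u_gt0 : 0 < 2 ^ u by rewrite expn_gt0.
have v_gt0 : 0 < 2 ^ v by rewrite expn_gt0.
have puv : 2 ^ u != 2 ^ v by rewrite eqn_exp2l.
set n := 2 ^ u + 2 ^ v.
pose G (Q : pred nat) := Q (2 ^ u) == Q (2 ^ v).
have := @toggle_invariant n _ (fun P => odd (num_descents n P) (+) G P).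
rewrite num_descents0 /G eqxx /= => H; suff : odd (num_descents n P) (+) G P = false.
  by rewrite /G; case: odd; case: eqP.
apply: (H) => [Q R QR|Q k kn].
  by rewrite (eq_num_descents QR) !QR //; lia.
rewrite odd_num_descents_toggle // odd_bin_pow2D !odd_bin_pow2 /toggle.
have -> : (k == 0) = false by lia.
have [-> | kv] := eqVneq k (2 ^ v).
  have -> : (2 ^ u <= 2 ^ v) && ((2 ^ v - 2 ^ u == 0) (+) (2 ^ v - 2 ^ u == 2 ^ v)) = false.
    by lia.
  rewrite /n addnK !odd_num_descents_pow2 (negbTE puv) addbF /=.
  by case: odd; case: (Q _); case: (Q _).
have [-> | ku] := eqVneq k (2 ^ u).
  rewrite leqnn subnn eqxx /n addKn !odd_num_descents_pow2 addbF /=.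
  have -> : (0 == 2 ^ v) = false by lia.
  by case: odd; case: (Q _); case: (Q _).
have -> : (2 ^ u <= k) && ((k - 2 ^ u == 0) (+) (k - 2 ^ u == 2 ^ v)) = false.
  by move: kn; rewrite /n; lia.
by rewrite /= !addbF.
Qed.

(** For y < z the sum lies strictly between 2^z and 2^(z+1). *)
Lemma pow2_neq_add x y z : y != z -> 2 ^ x != 2 ^ y + 2 ^ z.
Proof.
wlog yz : y z / y < z => [H yz|_].
  by have [/H|/H|E] := ltngtP y z; [apply| rewrite addnC; apply|]; lia.
have y_gt0 : 0 < 2 ^ y by rewrite expn_gt0.
have : 2 ^ y < 2 ^ z by rewrite ltn_exp2l.
have [xz|zx] := leqP x z.
  have le_xz : 2 ^ x <= 2 ^ z by rewrite leq_exp2l.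
  by lia.
have le_zx : 2 ^ z.+1 <= 2 ^ x by rewrite leq_exp2l.
by move: le_zx; rewrite expnS; lia.
Qed.

(** Cutting at 2^x, the binomial coefficient is odd, the left block has power-of-two length, and the
    hypothesis on [P] makes the right count odd. So the counts before and after the toggle have an
    odd sum. *)
Lemma odd_num_descents_toggle3 x y z (P : pred nat) :
  x != y -> x != z -> y != z ->
  P (2 ^ x + 2 ^ y) = P (2 ^ x + 2 ^ z) ->
  let n := 2 ^ x + (2 ^ y + 2 ^ z) in
  odd (num_descents n (toggle (2 ^ x) P)) = ~~ odd (num_descents n P).
Proof.
move=> xy xz yz Pxyz n.
have x_gt0 : 0 < 2 ^ x by rewrite expn_gt0.
have y_gt0 : 0 < 2 ^ y by rewrite expn_gt0.
have pxy : 2 ^ x != 2 ^ y by rewrite eqn_exp2l.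
have pxz : 2 ^ x != 2 ^ z by rewrite eqn_exp2l.
rewrite odd_num_descents_toggle; last by rewrite /n; lia.
rewrite /n addKn odd_num_descents_pow2 odd_num_descents_pow2D // Pxyz eqxx.
rewrite odd_bin_pow2D subnn bin0 odd_bin_pow2D odd_bin_pow2 leqnn !andbT /=.
have -> : (2 ^ x == 0) = false by lia.
have -> : (2 ^ y <= 2 ^ x) && odd 'C(2 ^ z, 2 ^ x - 2 ^ y) = false.
  rewrite odd_bin_pow2; have := pow2_neq_add x yz; lia.
by rewrite (negbTE pxz) /= addbT.
Qed.

Lemma pow2_mod8 x : [\/ 2 ^ x = 1, 2 ^ x = 2, 2 ^ x = 4 | 8 <= 2 ^ x /\ 2 ^ x %% 8 = 0].
Proof.
case: x => [|[|[|x]]]; [by constructor..|constructor 4].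
by rewrite -(addn3 x) expnD modnMl leq_pmull // expn_gt0.
Qed.

Lemma pow2D_neq7 x y : 2 ^ x + 2 ^ y != 7.
Proof.
by case: (pow2_mod8 x) => [->|->|->|[? _]]; case: (pow2_mod8 y) => [->|->|->|[? _]] //; lia.
Qed.

(** As 2^c exceeds 7 it drops out, and what is left is odd only if 7 is 2^a, 2^b or their sum. *)
Lemma even_bin7 a b c : 8 <= 2 ^ c -> odd 'C(2 ^ c + (2 ^ a + 2 ^ b), 7) = false.
Proof.
move=> c_ge; have neq7 x : (7 == 2 ^ x) = false.
  by case: (pow2_mod8 x) => [->|->|->|[? _]] //; lia.
rewrite odd_bin_pow2D leqNgt c_ge addbF odd_bin_pow2D !odd_bin_pow2 !neq7.
have := pow2D_neq7 a b; have := neq7 a.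
move: (2 ^ a) (2 ^ b) => i j; lia.
Qed.

(** Follows from k C(n, k) = n C(n - 1, k - 1). *)
Lemma dvdn_bin p n k : prime p -> 0 < k -> p %| n -> ~~ (p %| k) -> p %| 'C(n, k).
Proof.
move=> p_pr k_gt0 pn pk; case: n pn => [|n] pn; first by rewrite bin0n eqn0Ngt k_gt0.
have : p %| k.-1.+1 * 'C(n.+1, k.-1.+1) by rewrite -mul_bin_diag dvdn_mulr.
by rewrite prednK // Euclid_dvdM // (negbTE pk).
Qed.

Lemma odd_prime_ndvd_pow2 p k : prime p -> odd p -> ~~ (p %| 2 ^ k).
Proof.
move=> p_pr p_odd; rewrite Euclid_dvdX // negb_and dvdn_prime2 //.
by apply/orP; left; apply: contraTneq p_odd => ->.
Qed.

(** * The involution *)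

Definition pred_of_positions n (S : {set 'I_n}) : pred nat :=
  fun k => if insub k is Some i then i \in S else false.

Lemma pred_of_positionsE n (S : {set 'I_n}) (i : 'I_n) : pred_of_positions S i = (i \in S).
Proof. by rewrite /pred_of_positions valK. Qed.

Lemma beta_num_descents n (S : {set 'I_n}) : S \subset positions n ->
  beta S = num_descents n (pred_of_positions S).
Proof.
move/subsetP=> S_pos; apply: eq_card => s; rewrite !inE.
have val_pred (i j : 'I_n) : j = i.+1 :> nat -> ord_pred j = i.
  move=> ji; apply: val_inj; rewrite /= ji addSn /= modnDr modn_small //.
apply/eqP/has_descentsP => [<- i j ji|H].
  by rewrite pred_of_positionsE !inE (val_pred i) // ji.
apply/setP => j; rewrite !inE; have [j0|j_gt0] := posnP j.
  by apply/esym/negP => /S_pos; rewrite inE j0.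
have i_lt : j.-1 < n by have := ltn_ord j; lia.
have ji : j = (Ordinal i_lt).+1 :> nat by rewrite /= prednK.
by rewrite /= (val_pred _ _ ji) (H _ _ ji) pred_of_positionsE.
Qed.

Section Involution.
Variables (p n a b c : nat).
Hypotheses (p_pr : prime p) (p_odd : odd p) (p_neq7 : p != 7) (pn : p %| n).
Hypotheses (ab : a < b) (bc : b < c) (n_ge : 11 <= n).
Hypothesis nE : n = 2 ^ a + (2 ^ b + 2 ^ c).
Implicit Types (S : {set 'I_n}) (P : pred nat).

(* An exponent x in {a, b, c} such that S contains both or none of the two sums
   2 ^ x + 2 ^ y with y in {a, b, c} distinct from x. *)
Definition balanced_exp P : nat :=
  if P (2 ^ a + 2 ^ b) == P (2 ^ a + 2 ^ c) then a
  else if P (2 ^ a + 2 ^ b) == P (2 ^ b + 2 ^ c) then b else c.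

Lemma balanced_expP P :
  exists y z, let x := balanced_exp P in
   [/\ x != y, x != z, y != z, P (2 ^ x + 2 ^ y) = P (2 ^ x + 2 ^ z) &
       n = 2 ^ x + (2 ^ y + 2 ^ z)].
Proof.
rewrite /balanced_exp; case: eqP => [E|/eqP E1].
  by exists b, c; split => //; lia.
case: eqP => [E|/eqP E2].
  by exists a, c; split; rewrite // ?[2 ^ b + 2 ^ a]addnC //; lia.
(* The first of three Booleans differs from the other two, so these two, at the sums involving [c],
   agree. *)
exists a, b; split; try lia; rewrite ![2 ^ c + _]addnC.
by case: (P _) E1 E2; case: (P _); case: (P _).
Qed.

Definition toggle_balanced P : pred nat := toggle 7 (toggle (2 ^ balanced_exp P) P).

Lemma eq_balanced_exp P Q :
  (forall x y, x \in [:: a; b; c] -> y \in [:: a; b; c] -> x < y ->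
     P (2 ^ x + 2 ^ y) = Q (2 ^ x + 2 ^ y)) ->
  balanced_exp P = balanced_exp Q.
Proof.
by move=> PQ; rewrite /balanced_exp !PQ ?inE ?eqxx ?orbT //; lia.
Qed.

(** This makes the toggling an involution: neither 7 nor a power of 2 is a sum of two distinct
    powers of 2, so the positions that determine the exponent are untouched. *)
Lemma balanced_exp_toggle P : balanced_exp (toggle_balanced P) = balanced_exp P.
Proof.
apply: eq_balanced_exp => x y _ _ xy; rewrite /toggle_balanced /toggle.
have -> : (2 ^ x + 2 ^ y == 2 ^ balanced_exp P) = false.
  by rewrite eq_sym; apply/negbTE/pow2_neq_add; lia.
have -> : (2 ^ x + 2 ^ y == 7) = false.
  exact/negbTE/pow2D_neq7.
by rewrite !addbF.
Qed.

Lemma toggle_balancedK P i : toggle_balanced (toggle_balanced P) i = P i.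
Proof.
rewrite {1}/toggle_balanced balanced_exp_toggle /toggle_balanced /toggle.
by case: (P i); case: (i == _); case: (i == 7).
Qed.

Lemma num_descents_toggle_balanced P :
  num_descents n (toggle_balanced P) = num_descents n P %[mod p] /\
  odd (num_descents n (toggle_balanced P)) = ~~ odd (num_descents n P).
Proof.
have [y [z [xy xz yz Pxyz nE']]] := balanced_expP P.
rewrite /toggle_balanced; set x := balanced_exp P in xy xz Pxyz nE' *.
have x_gt0 : 0 < 2 ^ x by rewrite expn_gt0.
have y_gt0 : 0 < 2 ^ y by rewrite expn_gt0.
have x_in : 0 < 2 ^ x < n by rewrite nE'; lia.
have seven_in : 0 < 7 < n by lia.
have pdvd k Q : 0 < k < n -> ~~ (p %| k) ->
    p %| num_descents n Q + num_descents n (toggle k Q).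
  move=> kn pk; rewrite num_descents_toggle // dvdn_mulr //.
  by apply: dvdn_bin => //; case/andP: kn.
split.
  have px : ~~ (p %| 2 ^ x) by exact: odd_prime_ndvd_pow2.
  have p7 : ~~ (p %| 7) by rewrite dvdn_prime2.
  have := pdvd _ (toggle (2 ^ x) P) seven_in p7; have := pdvd _ P x_in px.
  set u := num_descents n P; set v := num_descents n _; set w := num_descents n _.
  (* Each of the two toggles changes the sign modulo [p]: u + v = 0 = v + w, hence w = u. *)
  move=> uv vw; apply/eqP; rewrite -(eqn_modDl v); move: uv vw.
  by rewrite addnC /dvdn => /eqP -> /eqP ->.
rewrite odd_num_descents_toggle //.
have -> : odd 'C(n, 7) = false.
  rewrite nE addnA addnC even_bin7 //.
  have ab2 : 2 ^ a < 2 ^ b by rewrite ltn_exp2l.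
  have bc2 : 2 ^ b < 2 ^ c by rewrite ltn_exp2l.
  move: n_ge ab2 bc2; rewrite nE.
  (* If 2^c were at most 4, [n] would be at most 4 + 2 + 1, so 2^c is at least 8. *)
  by case: (pow2_mod8 c) => [->|->|->|[? _]] //; lia.
by rewrite addbF [in LHS]nE' odd_num_descents_toggle3 // -nE'.
Qed.

Definition toggle_set S : {set 'I_n} :=
  [set i : 'I_n | toggle_balanced (pred_of_positions S) i].

Lemma pred_of_toggle_set S i : 0 < i < n ->
  pred_of_positions (toggle_set S) i = toggle_balanced (pred_of_positions S) i.
Proof.
by case/andP=> _ i_n; rewrite (pred_of_positionsE _ (Ordinal i_n)) inE.
Qed.

Lemma toggle_setK : involutive toggle_set.
Proof.
move=> S; apply/setP => i; rewrite inE -[RHS]pred_of_positionsE -[RHS]toggle_balancedK.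
(* [toggle_set] records only positions below [n]; the sums read by [balanced_exp] lie in that range,
   so the exponent is the same. *)
rewrite /toggle_balanced -(@eq_balanced_exp (toggle_balanced (pred_of_positions S))).
  by rewrite /toggle pred_of_positionsE inE.
move=> x y x_in y_in xy; rewrite pred_of_toggle_set //.
have x_gt0 : 0 < 2 ^ x by rewrite expn_gt0.
have ya : 2 ^ a < 2 ^ b by rewrite ltn_exp2l.
have yb : 2 ^ b < 2 ^ c by rewrite ltn_exp2l.
have a_gt0 : 0 < 2 ^ a by rewrite expn_gt0.
move: x_in y_in xy; rewrite !inE => /or3P[] /eqP -> /or3P[] /eqP ->; rewrite ?ltnn //; lia.
Qed.

Lemma toggle_set_positions S : (toggle_set S \subset positions n) = (S \subset positions n).
Proof.
suff H (T : {set 'I_n}) : T \subset positions n -> toggle_set T \subset positions n.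
  by apply/idP/idP => /H; rewrite ?toggle_setK.
move/subsetP=> T_pos; apply/subsetP => i; rewrite !inE /toggle_balanced /toggle.
have x_gt0 := expn_gt0 2 (balanced_exp (pred_of_positions T)).
rewrite pred_of_positionsE lt0n; apply: contraTneq => i0.
have iT : (i \in T) = false by apply/negP => /T_pos; rewrite inE i0.
rewrite iT i0; move: x_gt0; lia.
Qed.

Lemma beta_toggle_set S : S \subset positions n ->
  beta (toggle_set S) = beta S %[mod p] /\ odd (beta (toggle_set S)) = ~~ odd (beta S).
Proof.
move=> S_pos; rewrite !beta_num_descents ?toggle_set_positions //.
rewrite (eq_num_descents (@pred_of_toggle_set S)).
exact: num_descents_toggle_balanced.
Qed.

Lemma Cyclotomic_dvd_descent_poly :
  (map_poly (intr : int -> rat) 'Phi_(2 * p) %| descent_poly n)%R.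
Proof.
have p_gt0 := prime_gt0 p_pr.
have [w w_prim] : exists w : algC, ((2 * p)%N.-primitive_root w)%R.
  by case: (@C_prim_root_exists (2 * p)) => [|w]; [lia | exists w].
have wp : (w ^+ p = -1)%R.
  have /eqP : ((w ^+ p) ^+ 2 = 1)%R by rewrite -exprM mulnC prim_expr_order.
  rewrite sqrf_eq1 => /orP[|/eqP //]; rewrite -(prim_order_dvd w_prim).
  by move/dvdn_leq => /(_ p_gt0); lia.
have w_eq (i j : nat) : i = j %[mod p] -> odd i = ~~ odd j -> (w ^+ i = - w ^+ j)%R.
  move=> ij oij; rewrite (divn_eq i p) (divn_eq j p) ij !exprD ![(_ * p)%N]mulnC !exprM wp.
  rewrite -mulNr -[in LHS]signr_odd -[in RHS]signr_odd; congr (_ * _)%R.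
  (* With [p] odd and equal remainders, the opposite parities of [i] and [j] pass to the quotients,
     the exponents of w^p = -1. *)
  have : odd (i %/ p) = ~~ odd (j %/ p).
    move: oij; rewrite {1}(divn_eq i p) {1}(divn_eq j p) ij !oddD !oddM p_odd !andbT.
    by case: odd; case: odd; case: odd.
  by move=> ->; case: odd; rewrite /= ?expr0 ?expr1 ?opprK.
(* The minimal polynomial of [w] over the rationals is Phi_(2p), so divisibility amounts to
   vanishing at [w]. *)
have [q [qE q_monic qP]] := minCpolyP w.
have PhiE : map_poly (intr : int -> rat) 'Phi_(2 * p) = q.
  apply: (map_poly_inj (ratr : rat -> algC)).
  rewrite -qE (minCpoly_cyclotomic w_prim) -(Cintr_Cyclotomic w_prim).
  by rewrite -map_poly_comp; apply: eq_map_poly => z /=; rewrite ratr_int.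
rewrite PhiE -qP /root /descent_poly rmorph_sum /= horner_sum.
under eq_bigr => S _ do rewrite map_polyXn hornerXn.
set s := (\sum_(S | _) _)%R.
have : (s = - s)%R.
  rewrite {1}/s (reindex_inj (inv_inj toggle_setK)) /= -sumrN.
  under eq_bigl => S do rewrite toggle_set_positions.
  by apply: eq_bigr => S /beta_toggle_set[]; apply: w_eq.
by move/eqP; rewrite -addr_eq0 -mulr2n Num.Theory.mulrn_eq0.
Qed.

End Involution.

(** * Non-essential elements and residues of powers of 2 *)

Lemma nonessential_ndvd p n k : 1 < p -> p %| n -> 0 < k < n -> ~~ (p %| k) ->
  nonessential p n k.
Proof.
move=> p_gt1 pn kn pk; split=> // -[_ /(_ 0)].
(* The last digit of [n] in base [p] is 0, that of [k] is not. *)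
by rewrite /digit !expn0 !divn1 (eqP pn) leqn0 => k0; rewrite /dvdn k0 in pk.
Qed.

(** 7 is 111 in base 2, so essential would mean n = 7 modulo 8; three distinct powers of 2 achieve
    this only as 1 + 2 + 4, below 11. *)
Lemma nonessential_2_7 n a b c : a < b -> b < c -> n = 2 ^ a + (2 ^ b + 2 ^ c) ->
  11 <= n -> nonessential 2 n 7.
Proof.
move=> ab bc nE n_ge; split; first lia; case=> _ H.
have n_mod8 : n %% 8 = 7.
  have := H 0; have := H 1; have := H 2; rewrite /digit /=; lia.
move: n_ge n_mod8; rewrite nE.
have := pow2D_neq7 a b.
have ab2 : 2 ^ a < 2 ^ b by rewrite ltn_exp2l.
have bc2 : 2 ^ b < 2 ^ c by rewrite ltn_exp2l.
move: (pow2_mod8 a) (pow2_mod8 b) (pow2_mod8 c) ab2 bc2.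
move: (2 ^ a) (2 ^ b) (2 ^ c) => i j k.
by case=> [->|->|->|[? ?]]; case=> [->|->|->|[? ?]]; case=> [->|->|->|[? ?]]; lia.
Qed.

Theorem theorem6p3 (p : nat) (p_prime : prime p) (p_odd : odd p)
  (u : {unit 'F_p}) (u_two : (val u = 2%:R)%R)
  (g : nat) (g_order : g = #[u]%g) (g_even : ~~ odd g)
  (n a b c : nat) (n_eq : n = 2 ^ c + 2 ^ b + 2 ^ a)
  (hbc : b < c) (hab : a < b) (hn : 11 <= n)
  (habc : perm_eq [seq x %% g | x <- [:: a; b; c]]
                  [seq x %% g | x <- [:: 1; g %/ 2; g %/ 2]]) :
  [/\ nonessential p n (2 ^ c), nonessential p n (2 ^ b)
    & nonessential p n (2 ^ a)] /\
  (nonessential 2 n 7 /\ nonessential p n 7) /\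
  (map_poly (intr : int -> rat) 'Phi_(2 * p) %| descent_poly n)%R.
Proof.
have nE : n = 2 ^ a + (2 ^ b + 2 ^ c) by lia.
have p_gt1 := prime_gt1 p_prime.
have g_gt0 : 0 < g by rewrite g_order order_gt0.
have two_exp k : (2%:R ^+ k = val (u ^+ k)%g :> 'F_p)%R by rewrite FinRing.val_unitX u_two.
have two_mod k : (2%:R ^+ (k %% g) = 2%:R ^+ k :> 'F_p)%R.
  by rewrite !two_exp g_order expg_mod_order.
(* The square is 1, and 2^(g/2) is not 1 because 0 < g/2 < g and [g] is the order. *)
have two_half : (2%:R ^+ (g %/ 2) = -1 :> 'F_p)%R.
  have /eqP : ((2%:R ^+ (g %/ 2)) ^+ 2 = 1 :> 'F_p)%R.
    by rewrite -exprM divnK ?dvdn2 // -two_mod modnn.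
  rewrite sqrf_eq1 => /orP[|/eqP //]; rewrite two_exp => u1.
  have : (u ^+ (g %/ 2) == 1)%g by apply/eqP/val_inj/eqP.
  by rewrite -order_dvdn -g_order => /dvdn_leq; lia.
have pn : p %| n.
  have : (n%:R = 0 :> 'F_p)%R.
    have sumE (s : seq nat) : (\sum_(x <- s) 2%:R ^+ x =
        \sum_(y <- [seq (x %% g)%N | x <- s]) 2%:R ^+ y :> 'F_p)%R.
      by rewrite big_map; apply: eq_bigr => x _; rewrite two_mod.
    have -> : (n%:R = \sum_(x <- [:: a; b; c]) 2%:R ^+ x :> 'F_p)%R.
      by rewrite nE !big_cons big_nil addr0 !natrD !natrX.
    (* Reducing exponents modulo [g] turns the sum into 2 + 2^(g/2) + 2^(g/2) = 2 - 1 - 1. *)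
    rewrite sumE (perm_big _ habc) -sumE !big_cons big_nil two_half.
    by rewrite addr0 expr1 -opprD -(natrD _ 1 1) subrr.
  by move/eqP; rewrite -(dvdn_pcharf (pchar_Fp p_prime)).
(* Modulo 7 one has 2^3 = 8 = 1, so [g] would divide 3 and be odd. *)
have p7 : p != 7.
  apply: contraNneq g_even => p7.
  have : (u ^+ 3 == 1)%g.
    have p0 : (7%:R = 0 :> 'F_p)%R.
      by apply/eqP; rewrite -(dvdn_pcharf (pchar_Fp p_prime)) p7.
    by apply/eqP/val_inj; rewrite -two_exp -natrX (natrD _ 1 7) p0 addr0.
  rewrite -order_dvdn -g_order => g3.
  have g_le3 : g <= 3 by apply: dvdn_leq.
  by move: g_gt0 g3 g_le3; case: (g) => [|[|[|[|]]]].
have pow_ndvd k : ~~ (p %| 2 ^ k) by exact: odd_prime_ndvd_pow2.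
have p_n7 : ~~ (p %| 7) by rewrite dvdn_prime2.
have a_gt0 : 0 < 2 ^ a by rewrite expn_gt0.
have b_gt0 : 0 < 2 ^ b by rewrite expn_gt0.
have c_gt0 : 0 < 2 ^ c by rewrite expn_gt0.
split; first by split; apply: nonessential_ndvd => //; lia.
split; first split.
- exact: (nonessential_2_7 hab hbc).
- by apply: nonessential_ndvd => //; lia.
- exact: (@Cyclotomic_dvd_descent_poly p n a b c).
Qed.
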